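(* Let $E\subseteq\mathbb{R}^d$ be a bounded measurable set, let $K$ be a countable index set, let $\varphi$ be a (complex-valued) measurable function defined on $\mathbb{R}^d$, and let $\{\psi_k\}_{k\in K}$ be a frame of $L^2(E)$. Then $\{\varphi\psi_k\}_{k\in K}$ is a Bessel sequence of $L^2(E)$ if and only if there exists a constant $B>0$ such that $|\varphi(t)|\le B$ for a.e. $t\in E$.
   Context: A sequence $\{\psi_k\}_{k\in K}$ in a separable Hilbert space $\mathcal{H}$ is a frame for $\mathcal{H}$ if there are constants $A,B>0$ with $A\|f\|^2\le\sum_{k\in K}|\langle f,\psi_k\rangle|^2\le B\|f\|^2$ for all $f\in\mathcal{H}$. It is a Bessel sequence if the right-hand inequality holds for some $B>0$ and all $f\in\mathcal H$. Saying that $\{\varphi\psi_k\}$ is a Bessel sequence of $L^2(E)$ includes $\varphi\psi_k\in L^2(E)$ for all $k$ (restricting $\varphi$ to $E$). *)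

(* Defs.v *)
From HB Require Import structures.
From mathcomp Require Import all_boot all_order all_algebra.
From mathcomp Require Import all_classical all_reals all_analysis.
From mathcomp.real_closed Require Import complex.

Set Implicit Arguments.
Unset Strict Implicit.
Unset Printing Implicit Defensive.

Import Order.TTheory GRing.Theory Num.Theory.
Import numFieldNormedType.Exports.

Local Open Scope classical_set_scope.
Local Open Scope ring_scope.

Section lebesgue_outer_measure.
Context {R : realType} {d : nat}.
Implicit Types (X : set 'rV[R]_d) (p : 'rV[R]_d * 'rV[R]_d).

Definition box p : set 'rV[R]_d :=
  [set x | forall i, p.1 0 i <= x 0 i <= p.2 0 i].

(* When some p.2 0 i < p.1 0 i, the box is empty and its volume is 0. *)
Definition box_volume p : R := \prod_(i < d) Num.max 0 (p.2 0 i - p.1 0 i).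

(* The covering families are indexed by arbitrary sets of naturals, so that
   the empty family is allowed: for d = 0 every box has volume 1. *)
Definition box_cover X (D : set nat) (F : nat -> 'rV[R]_d * 'rV[R]_d) :=
  X `<=` \bigcup_(n in D) box (F n).

Definition lebesgue_outer X : \bar R :=
  ereal_inf [set s : \bar R | exists D F, box_cover X D F /\
    s = (\esum_(n in D) (box_volume (F n))%:E)%E].

Local Open Scope ereal_scope.

Lemma box_volume_ge0 p : (0 <= box_volume p)%R.
Proof. by apply: prodr_ge0 => i _; rewrite le_max lexx. Qed.

Lemma lebesgue_outer_ge0 X : 0 <= lebesgue_outer X.
Proof.
apply: le_ereal_inf_tmp => _ [D [F [_ ->]]].
by apply: esum_ge0 => n _; rewrite lee_fin box_volume_ge0.
Qed.

Lemma lebesgue_outer0 : lebesgue_outer set0 = 0.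
Proof.
apply/eqP; rewrite eq_le lebesgue_outer_ge0 andbT.
apply: ereal_inf_lbound; exists set0, (fun=> (0%R, 0%R)).
by split; [exact: sub0set|rewrite esum_set0].
Qed.

Lemma le_lebesgue_outer :
  {homo lebesgue_outer : A B / A `<=` B >-> A <= B}.
Proof.
move=> A B AB; apply: ereal_inf_le_tmp => _ [D [F [BF ->]]].
by exists D, F; split => //; exact: subset_trans BF.
Qed.

Lemma lebesgue_outer_sigma_subadditive : sigma_subadditive lebesgue_outer.
Proof.
move=> A; have [[i ioo]|] := pselect (exists i, lebesgue_outer (A i) = +oo).
  rewrite (eseries_pinfty _ _ ioo) ?leey// => n _.
  by rewrite -ltNye (lt_le_trans _ (lebesgue_outer_ge0 _)).
rewrite -forallNE => Aoo.
suff add2e (e : {posnum R}) : lebesgue_outer (\bigcup_n A n) <=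
    \sum_(i <oo) lebesgue_outer (A i) + e%:num%:E.
  by apply/lee_addgt0Pr => _/posnumP[].
rewrite (le_trans _ (epsilon_trick _ _ _))//; last first.
  by move=> n; exact: lebesgue_outer_ge0.
pose vol p := (box_volume p)%:E.
pose P n (G : set nat * (nat -> 'rV[R]_d * 'rV[R]_d)) :=
  box_cover (A n) G.1 G.2 /\
  \esum_(k in G.1) vol (G.2 k) <=
    lebesgue_outer (A n) + (e%:num / (2 ^ n.+1)%:R)%:E.
have [G PG] : {G & forall n, P n (G n)}.
  apply: (@choice _ _ P) => n; rewrite /P.
  have en1 : (0 < e%:num / (2 ^ n.+1)%:R :> R)%R by [].
  have fA : lebesgue_outer (A n) \is a fin_num.
    by rewrite ge0_fin_numE ?lebesgue_outer_ge0// ltey; apply/eqP/Aoo.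
  have [_ [D [F [AF ->]]] DF] := lb_ereal_inf_adherent en1 fA.
  by exists (D, F); split => //=; exact: ltW.
have /card_esym/ppcard_eqP[f] := card_nat2.
pose D := [set n | (G (f n).1).1 (f n).2].
pose F n := (G (f n).1).2 (f n).2.
apply: (@le_trans _ _ (\esum_(n in D) vol (F n))).
  apply: ereal_inf_lbound; exists D, F; split => // t [i _ Ait].
  have [j Dj Fj] := (PG i).1 _ Ait.
  by exists (f^-1%FUN (i, j)); rewrite /D /F /= invK ?inE.
pose J i := (G i).1.
have bijf : set_bij D (setT `*`` J) f.
  split.
  - by move=> n Dn; split.
  - by move=> m n _ _; apply: (@inj _ _ setT f); rewrite inE.
  - move=> [i j] [_ Jij]; exists (f^-1%FUN (i, j)).
      by rewrite /D /= invK ?inE.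
    by rewrite invK ?inE.
rewrite -(reindex_esum _ _ _ (fun k => vol ((G k.1).2 k.2)) bijf).
rewrite -(@esum_esum _ _ _ setT J (fun i j => vol ((G i).2 j))); last first.
  by move=> i j _ _; rewrite lee_fin box_volume_ge0.
rewrite -nneseries_esumT; last first.
  by move=> i; apply: esum_ge0 => j _; rewrite lee_fin box_volume_ge0.
apply: lee_nneseries => n _; last exact: (PG n).2.
by move=> _; apply: esum_ge0 => j _; rewrite lee_fin box_volume_ge0.
Qed.

HB.instance Definition _ := isOuterMeasure.Build R 'rV[R]_d lebesgue_outer
  lebesgue_outer0 lebesgue_outer_ge0 le_lebesgue_outer
  lebesgue_outer_sigma_subadditive.

End lebesgue_outer_measure.

(* R^d with the sigma-algebra of Lebesgue (not just Borel) measurable sets *)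
Notation lebesgue_space R d := (caratheodory_type (@lebesgue_outer R d)).

Definition lebesgue_measure_rV (R : realType) (d : nat) :
  set (lebesgue_space R d) -> \bar R := @lebesgue_outer R d.
HB.instance Definition _ (R : realType) (d : nat) :=
  isMeasure.Build _ _ _ (@lebesgue_measure_rV R d)
    (@caratheodory_measure0 _ _ (@lebesgue_outer R d))
    (@caratheodory_measure_ge0 _ _ (@lebesgue_outer R d))
    (@caratheodory_measure_sigma_additive _ _ (@lebesgue_outer R d)).

Section L2.
Context {d : measure_display} {T : measurableType d} {R : realType}.
Implicit Types (D : set T) (f g : T -> R[i]).

Definition cmeasurable_fun D f :=
  measurable_fun D (fun x => complex.Re (f x)) /\
  measurable_fun D (fun x => complex.Im (f x)).

Variable mu : {measure set T -> \bar R}.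

Definition cintegral D f : R[i] :=
  ((\int[mu]_(x in D) complex.Re (f x)) +i*
   (\int[mu]_(x in D) complex.Im (f x)))%C.

(* Elements of L^2(D) are given by representatives, which are functions on the
   whole space whose values outside D are irrelevant. *)
Definition L2 D : set (T -> R[i]) :=
  [set f | cmeasurable_fun D f /\
    (\int[mu]_(x in D) (Normc.normc (f x) ^+ 2)%:E < +oo)%E].

Definition L2_inner D f g : R[i] := cintegral D (fun x => f x * (g x)^*%C).

End L2.

Section frames.
Context {R : realType} {V : Type} {K : countType}.
Variables (H : set V) (inner : V -> V -> R[i]).
Implicit Types (f : V) (psi : K -> V).

Definition inner_norm f : R := Num.sqrt (complex.Re (inner f f)).

Definition coef_sum psi f : \bar R :=
  (\esum_(k in [set: K]) (Normc.normc (inner f (psi k)) ^+ 2)%:E)%E.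

Definition is_frame psi := (forall k, H (psi k)) /\
  exists A B : R, [/\ 0 < A, 0 < B & forall f, H f ->
    ((A * inner_norm f ^+ 2)%:E <= coef_sum psi f)%E /\
    (coef_sum psi f <= (B * inner_norm f ^+ 2)%:E)%E].

Definition is_Bessel psi := (forall k, H (psi k)) /\
  exists B : R, 0 < B /\ forall f, H f ->
    (coef_sum psi f <= (B * inner_norm f ^+ 2)%:E)%E.

End frames.

(* Main.v *)
(** Since <f, phi psi_k> = <phi^* f, psi_k>, the coefficients of f against
    (phi psi_k) are those of phi^* f against (psi_k). If |phi| <= C almost
    everywhere, then ||phi^* f|| <= C ||f||, and the upper frame bound gives the
    Bessel bound. Conversely, the lower frame bound A and the Bessel bound B give
    A ||phi^* f||^2 <= B ||f||^2 as soon as f and phi^* f are in L^2. For f the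
    indicator of S = {t in E | C < |phi t| <= n} with A C^2 = B + 1, this reads
    (B + 1) mu(S) <= B mu(S), and mu(S) is finite because E is bounded, so S is
    null for every n. *)
Require Import Defs.
From HB Require Import structures.
From mathcomp Require Import all_boot all_order all_algebra.
From mathcomp Require Import all_classical all_reals all_analysis.
From mathcomp Require Import measurable_realfun.
From mathcomp.real_closed Require Import complex.
From mathcomp Require Import ring lra.

Set Implicit Arguments.
Unset Strict Implicit.
Unset Printing Implicit Defensive.

Import Order.TTheory GRing.Theory Num.Theory.
Import numFieldNormedType.Exports.
Local Open Scope classical_set_scope.
Local Open Scope ring_scope.

(** * The modulus of a complex number *)

Lemma normc_ge0 (R : realType) (z : R[i]) : 0 <= Normc.normc z.
Proof. by case: z => a b; exact: sqrtr_ge0. Qed.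

(** Without the square root, measurability and algebraic identities for the squared modulus become
    polynomial. *)
Lemma sqr_normcE (R : realType) (z : R[i]) :
  Normc.normc z ^+ 2 = complex.Re z ^+ 2 + complex.Im z ^+ 2.
Proof. by case: z => a b; rewrite /= sqr_sqrtr// addr_ge0// sqr_ge0. Qed.

Lemma Re_mul_conjc (R : realType) (z : R[i]) :
  complex.Re (z * z^*%C) = Normc.normc z ^+ 2.
Proof. by rewrite sqr_normcE; case: z => a b /=; ring. Qed.

Lemma normc_conjc (R : realType) (z : R[i]) :
  Normc.normc z^*%C = Normc.normc z.
Proof. by case: z => a b /=; rewrite sqrrN. Qed.

(** * Measurability, norms and domination in [L2] *)

Section L2_theory.
Context {disp : measure_display} {T : measurableType disp} {R : realType}.
Implicit Types (D S : set T) (f g phi : T -> R[i]).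

Lemma cmeasurable_funM D f g : cmeasurable_fun D f -> cmeasurable_fun D g ->
  cmeasurable_fun D (fun t => f t * g t).
Proof.
move=> [fr fi] [gr gi]; split.
- rewrite (_ : (fun t => _) = (fun t =>
    complex.Re (f t) * complex.Re (g t) - complex.Im (f t) * complex.Im (g t))).
    by apply: measurable_funB; exact: measurable_funM.
  by apply/funext => t; case: (f t) (g t) => [a b] [].
- rewrite (_ : (fun t => _) = (fun t =>
    complex.Re (f t) * complex.Im (g t) + complex.Im (f t) * complex.Re (g t))).
    by apply: measurable_funD; exact: measurable_funM.
  by apply/funext => t; case: (f t) (g t) => [a b] [].
Qed.

Lemma cmeasurable_fun_conjc D f : cmeasurable_fun D f ->
  cmeasurable_fun D (fun t => (f t)^*%C).
Proof.
move=> [fr fi]; split.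
- rewrite (_ : (fun t => _) = (fun t => complex.Re (f t)))//.
  by apply/funext => t; case: (f t).
- rewrite (_ : (fun t => _) = (fun t => - complex.Im (f t))).
    exact: measurable_funN.
  by apply/funext => t; case: (f t).
Qed.

Lemma cmeasurable_fun_indic D S : measurable S ->
  cmeasurable_fun D (fun t => (\1_S t)%:C%C : R[i]).
Proof. by move=> mS; split => /=; [exact: measurable_indic|]. Qed.

Lemma measurable_sqr_normc D f : cmeasurable_fun D f ->
  measurable_fun D (fun t => Normc.normc (f t) ^+ 2).
Proof.
move=> [fr fi]; under eq_fun do rewrite sqr_normcE.
by apply: measurable_funD; exact: measurable_funX.
Qed.

Variable mu : {measure set T -> \bar R}.

(** [inner_norm] is built on the real-valued integral, which sends an infinite value to 0;
    membership in [L2] excludes that case. *)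
Lemma sqr_inner_normE D f : L2 mu D f ->
  ((inner_norm (L2_inner mu D) f ^+ 2)%:E =
   \int[mu]_(t in D) (Normc.normc (f t) ^+ 2)%:E)%E.
Proof.
move=> [_ ffin]; rewrite /inner_norm /L2_inner /=.
under eq_Rintegral do rewrite Re_mul_conjc.
have I0 : (0 <= \int[mu]_(t in D) (Normc.normc (f t) ^+ 2)%:E)%E.
  by apply: integral_ge0 => t _; rewrite lee_fin sqr_ge0.
by rewrite sqr_sqrtr ?fine_ge0// fineK// ge0_fin_numE.
Qed.

Lemma L2_le_normc D f g (C : R) : measurable D -> L2 mu D f ->
  cmeasurable_fun D g ->
  {ae mu, forall t, D t -> Normc.normc (g t) <= C * Normc.normc (f t)} ->
  L2 mu D g /\ (\int[mu]_(t in D) (Normc.normc (g t) ^+ 2)%:E <=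
    (C ^+ 2)%:E * \int[mu]_(t in D) (Normc.normc (f t) ^+ 2)%:E)%E.
Proof.
move=> mD [mf ffin] mg gf.
have mf2 := measurable_sqr_normc mf; have mg2 := measurable_sqr_normc mg.
suff le_int : (\int[mu]_(t in D) (Normc.normc (g t) ^+ 2)%:E <=
    (C ^+ 2)%:E * \int[mu]_(t in D) (Normc.normc (f t) ^+ 2)%:E)%E.
  split => //; split => //; apply: (le_lt_trans le_int).
  by rewrite lte_mul_pinfty// lee_fin sqr_ge0.
rewrite -ge0_integralZl_EFin ?sqr_ge0//; last 2 first.
- by move=> t _; rewrite lee_fin sqr_ge0.
- exact/measurable_EFinP.
apply: ae_ge0_le_integral => //.
- by move=> t _; rewrite lee_fin sqr_ge0.
- exact/measurable_EFinP.
- by move=> t _; rewrite -EFinM lee_fin mulr_ge0// sqr_ge0.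
- by apply/measurable_EFinP; exact: measurable_funM.
- apply: filterS gf => t gft Dt; rewrite -EFinM lee_fin -exprMn.
  (* The sign of [C] is unknown, but [C * Normc.normc (f t)] dominates a modulus, hence is
     nonnegative and the bound can be squared. *)
  have := gft Dt; have := normc_ge0 (g t) => g0 gC.
  by rewrite ler_pXn2r// nnegrE// (le_trans g0).
Qed.

(** * Multiplication by a function, and its adjoint *)

Lemma L2_inner_mulr D phi f g :
  L2_inner mu D f (fun t => phi t * g t) =
  L2_inner mu D (fun t => (phi t)^*%C * f t) g.
Proof.
rewrite /L2_inner; congr (cintegral _ _ _); apply/funext => t.
by rewrite rmorphM/= mulrCA mulrA.
Qed.

Lemma coef_sum_mulr (K : countType) D phi f (psi : K -> T -> R[i]) :
  Defs.coef_sum (L2_inner mu D) (fun k t => phi t * psi k t) f =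
  Defs.coef_sum (L2_inner mu D) psi (fun t => (phi t)^*%C * f t).
Proof. by apply: eq_esum => k _; rewrite L2_inner_mulr. Qed.

Lemma is_Bessel_mul (K : countType) D phi (psi : K -> T -> R[i]) (C : R) :
  measurable D -> cmeasurable_fun D phi ->
  {ae mu, forall t, D t -> Normc.normc (phi t) <= C} ->
  is_Bessel (L2 mu D) (L2_inner mu D) psi ->
  is_Bessel (L2 mu D) (L2_inner mu D) (fun k t => phi t * psi k t).
Proof.
move=> mD mphi phiC [psiL2 [B [B0 psiB]]]; split.
  move=> k; apply: (@L2_le_normc D (psi k) _ C mD (psiL2 k) _ _).1.
    by apply: cmeasurable_funM => //; exact: (psiL2 k).1.
  apply: filterS phiC => t phiC Dt; rewrite Normc.normcM.
  by rewrite ler_wpM2r ?normc_ge0// phiC.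
(* Adding 1 keeps the Bessel bound positive even if [C] is 0. *)
exists (B * (1 + C ^+ 2)); split; first by rewrite mulr_gt0// ltr_wpDr// sqr_ge0.
move=> f fL2; rewrite coef_sum_mulr.
have [||gL2 gle] := @L2_le_normc D f (fun t => (phi t)^*%C * f t) C mD fL2.
- by apply: cmeasurable_funM; [exact: cmeasurable_fun_conjc|exact: fL2.1].
- apply: filterS phiC => t phiC Dt; rewrite Normc.normcM normc_conjc.
  by rewrite ler_wpM2r ?normc_ge0// phiC.
apply: (le_trans (psiB _ gL2)); rewrite lee_fin -mulrA ler_pM2l//.
move: gle; rewrite -!sqr_inner_normE// -EFinM lee_fin => /le_trans; apply.
by rewrite ler_wpM2r ?sqr_ge0// lerDr.
Qed.

(** Since [mu D] is finite, indicators of measurable subsets of [D] lie in [L2] and can serve as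
    test functions. *)
Lemma mul_Bessel_ae_bounded (K : countType) D phi (psi : K -> T -> R[i]) :
  measurable D -> (mu D < +oo)%E -> cmeasurable_fun D phi ->
  is_frame (L2 mu D) (L2_inner mu D) psi ->
  is_Bessel (L2 mu D) (L2_inner mu D) (fun k t => phi t * psi k t) ->
  exists C : R, 0 < C /\ {ae mu, forall t, D t -> Normc.normc (phi t) <= C}.
Proof.
move=> mD Dfin mphi [_ [A [B1 [A0 _ psiA]]]] [_ [B [B0 phipsiB]]].
have BA0 : 0 < (B + 1) / A by rewrite divr_gt0// addr_gt0.
pose C := Num.sqrt ((B + 1) / A).
have C2 : A * C ^+ 2 = B + 1.
  by rewrite sqr_sqrtr ?ltW// mulrC divfK ?gt_eqF.
have C0 : 0 < C by rewrite sqrtr_gt0.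
exists C; split => //.
have mphi2 := measurable_sqr_normc mphi.
(* The lower cut contradicts the Bessel bound unless [S n] is null; the upper cut keeps the product
   of [phi] with the indicator in [L2]. Squares make [S n] a preimage under the measurable map of
   [mphi2]. *)
pose S (n : nat) := D `&` [set t | C ^+ 2 < Normc.normc (phi t) ^+ 2 <= n%:R ^+ 2].
have mS n : measurable (S n).
  rewrite /S (_ : [set t | _] = (fun t => Normc.normc (phi t) ^+ 2) @^-1`
    `]C ^+ 2, n%:R ^+ 2]); first exact: mphi2.
  by apply/seteqP; split => t; rewrite /= in_itv.
suff S0 n : mu (S n) = 0%E.
  apply: (@negligibleS _ _ _ _ (\bigcup_n S n)); last first.
    by apply: negligible_bigcup => n; apply/negligibleP; [exact: mS|exact: S0].
  move=> t /= /not_implyP[Dt /negP]; rewrite -ltNge => Cphi.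
  (* The successor of the integer part exceeds the modulus, so the sets [S n] exhaust the
     exceptional set. *)
  exists (Num.truncn (Normc.normc (phi t))).+1 => //; split => //=.
  rewrite !ltr_pXn2r ?nnegrE ?normc_ge0 ?(ltW C0)// Cphi/=.
  by rewrite ler_pXn2r ?nnegrE ?normc_ge0 ?ler0n// ltW// truncnS_gt.
have SD : S n `&` D = S n by apply/setIidPl => t [].
have Sfin : mu (S n) \is a fin_num.
  rewrite ge0_fin_numE// (le_lt_trans _ Dfin)// le_measure ?inE//.
  by move=> t [].
pose f t : R[i] := (\1_(S n) t)%:C%C.
have normf t : Normc.normc (f t) ^+ 2 = \1_(S n) t.
  by rewrite sqr_normcE/= expr0n addr0 indicE; case: (_ \in _); rewrite ?expr0n ?expr1n.
have mf : cmeasurable_fun D f by exact: cmeasurable_fun_indic.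
have intf : (\int[mu]_(t in D) (Normc.normc (f t) ^+ 2)%:E = mu (S n))%E.
  by under eq_integral do rewrite normf; rewrite integral_indic// SD.
have fL2 : L2 mu D f by split => //; rewrite intf ltey_eq Sfin.
pose g t := (phi t)^*%C * f t.
have normg t : Normc.normc (g t) ^+ 2 = Normc.normc (phi t) ^+ 2 * \1_(S n) t.
  by rewrite Normc.normcM normc_conjc exprMn normf.
have mg : cmeasurable_fun D g.
  by apply: cmeasurable_funM => //; exact: cmeasurable_fun_conjc.
have gL2 : L2 mu D g.
  (* The modulus of [g] is at most [n] times that of [f]: by the upper cut on [S n], and because
     both vanish elsewhere. *)
  apply: (@L2_le_normc D f g n%:R mD fL2 mg _).1.
  apply: aeW => t Dt.
  rewrite -(@ler_pXn2r _ 2%N)// ?nnegrE ?mulr_ge0 ?normc_ge0//.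
  rewrite exprMn normg normf indicE; have [|_] := boolP (t \in S n).
    by rewrite inE => -[_ /andP[_]]; rewrite !mulr1.
  by rewrite !mulr0.
have intg : ((C ^+ 2)%:E * mu (S n) <=
    \int[mu]_(t in D) (Normc.normc (g t) ^+ 2)%:E)%E.
  rewrite -intf -ge0_integralZl_EFin ?sqr_ge0//; last 2 first.
  - by move=> t _; rewrite lee_fin sqr_ge0.
  - by apply/measurable_EFinP; exact: measurable_sqr_normc.
  apply: ge0_le_integral => //.
  - by move=> t _; rewrite -EFinM lee_fin mulr_ge0// sqr_ge0.
  - apply/measurable_EFinP; apply: measurable_funM => //.
    exact: measurable_sqr_normc.
  - by apply/measurable_EFinP; exact: measurable_sqr_normc.
  - move=> t Dt; rewrite -EFinM lee_fin normg normf indicE.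
    have [|_] := boolP (t \in S n); last by rewrite !mulr0.
    by rewrite inE => -[_ /andP[/ltW ? _]]; rewrite !mulr1.
(* The lower frame bound at [g] and the Bessel bound at [f] meet in the same coefficient sum. *)
have := (psiA g gL2).1; rewrite -coef_sum_mulr => /le_trans/(_ (phipsiB f fL2)).
rewrite [(A * _)%:E]EFinM [(B * _)%:E]EFinM !sqr_inner_normE// intf => AB.
have A0E : (0 <= A%:E)%E by rewrite lee_fin ltW.
have := le_trans (lee_wpmul2l A0E intg) AB.
(* For [m = fine (mu (S n))] this is the real inequality [(B + 1) * m <= B * m]; an infinite measure
   would have made it vacuous. *)
rewrite -(fineK Sfin) -!EFinM lee_fin mulrA C2 => le_m.
have m0 : 0 <= fine (mu (S n)) by rewrite fine_ge0.
by congr EFin; apply/eqP; rewrite eq_le m0 andbT; lra.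
Qed.

End L2_theory.

(** A single cube covers the set, and its volume is finite. *)
Lemma bounded_set_lebesgue_outer (R : realType) (d : nat) (E : set 'rV[R]_d) :
  bounded_set E -> (lebesgue_outer E < +oo)%E.
Proof.
(* Boundedness provides only radii strictly above [M], hence [M + 1]. *)
move=> [M [_ /(_ (M + 1))]]; rewrite ltrDl ltr01 => /(_ isT) EM.
pose p : 'rV[R]_d * 'rV[R]_d := (const_mx (- (M + 1)), const_mx (M + 1)).
apply: (@le_lt_trans _ _ (box_volume p)%:E); last exact: ltry.
apply: ereal_inf_lbound; exists [set 0%N], (fun=> p).
split; last by rewrite esum_set1// lee_fin box_volume_ge0.
move=> x /EM xM; exists 0%N => //= i.
(* The norm of a row vector is the maximum of its entries in absolute value, so balls are cubes. *)
rewrite !mxE -ler_norml (le_trans _ xM)// [leRHS]/Num.Def.normr/= mx_normrE.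
by apply/bigmax_geP; right; exists (0, i).
Qed.

Theorem proposition3p5 (R : realType) (d : nat) (E : set 'rV[R]_d)
  (E_bounded : bounded_set E)
  (E_measurable : measurable (E : set (lebesgue_space R d)))
  (K : countType)
  (phi : lebesgue_space R d -> R[i])
  (phi_measurable : cmeasurable_fun setT phi)
  (psi : K -> lebesgue_space R d -> R[i])
  (psi_frame : is_frame (L2 (@lebesgue_measure_rV R d) E)
                        (L2_inner (@lebesgue_measure_rV R d) E) psi) :
  is_Bessel (L2 (@lebesgue_measure_rV R d) E)
            (L2_inner (@lebesgue_measure_rV R d) E)
            (fun k t => phi t * psi k t)
  <->
  exists B : R, 0 < B /\
    {ae @lebesgue_measure_rV R d, forall t, E t -> Normc.normc (phi t) <= B}.
Proof.
have mphi : cmeasurable_fun (E : set (lebesgue_space R d)) phi.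
  by case: phi_measurable => mr mi; split; exact: measurable_funTS.
split.
- apply: mul_Bessel_ae_bounded => //.
  (* [lebesgue_measure_rV] is the outer measure by definition, so the bound applies as it stands. *)
  exact: bounded_set_lebesgue_outer.
- move=> [B [_ phiB]]; apply: (is_Bessel_mul _ _ phiB) => //.
  have [psiL2 [A [B' [_ B'0 psiAB]]]] := psi_frame.
  by split => //; exists B'; split => // f /psiAB[].
Qed.
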